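(* Let $S$ be a Coe-semigroup with $S\neq\mathbb{N}$. Then $S\cup\{F(S)-1,F(S)\}$ is a Coe-semigroup.
   Context: $\mathbb{N}=\{0,1,2,\ldots\}$. A numerical semigroup is a subset of $\mathbb{N}$ containing $0$, closed under addition and with finite complement in $\mathbb{N}$. A numerical semigroup $S$ is a Coe-semigroup if $\{x-1,x+1\}\subseteq S$ for every odd $x\in S$. The Frobenius number is $F(S)=\max(\mathbb{Z}\setminus S)$. *)

(* Defs.v *)
From mathcomp Require Import all_boot all_order all_algebra.
From mathcomp Require Import boolp classical_sets functions cardinality.

Set Implicit Arguments.
Unset Strict Implicit.
Unset Printing Implicit Defensive.

Import Order.TTheory GRing.Theory Num.Theory.
Local Open Scope classical_set_scope.
Local Open Scope ring_scope.

(* Subsets of N are represented as sets of integers included in [natset], since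
   the Frobenius number is the maximum of a set of integers (it is -1 for N);
   thus all subtractions below are genuine ones. *)
Definition natset : set int := [set x | 0 <= x].

Definition numerical_semigroup (S : set int) : Prop :=
  [/\ S `<=` natset,
      S 0,
      (forall x y, S x -> S y -> S (x + y)) &
      finite_set (natset `\` S)].

Definition coe_semigroup (S : set int) : Prop :=
  numerical_semigroup S /\
  (forall x, S x -> odd `|x|%N -> [set x - 1; x + 1] `<=` S).

Definition is_maximum (A : set int) (m : int) : Prop := A m /\ ubound A m.

(* [xget] picks the maximum of the complement of S in the integers, which exists
   and is unique when S is a numerical semigroup; the default value 0 is only
   taken when there is no maximum. *)
Definition frobenius (S : set int) : int := xget 0 (is_maximum (~` S)).

(* Main.v *)
(* Every integer greater than F = F(S) lies in S, so S ∪ {F-1, F} is S together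
   with all integers at least F-1; hence it is closed under addition.  If F were
   even, the odd element F+1 of S would force F into S; hence F is odd, and the
   only new odd element F has its neighbours F-1 and F+1 in the union. *)
Require Import Defs.
From mathcomp Require Import all_boot all_order all_algebra.
From mathcomp Require Import boolp classical_sets functions cardinality.
From mathcomp Require Import zify.

Import Order.TTheory GRing.Theory Num.Theory.
Local Open Scope classical_set_scope.
Local Open Scope ring_scope.

(** The largest absolute value serves as bound, a natural number as [ex_maxnP] requires. *)
Lemma finite_set_int_bounded (A : set int) :
  finite_set A -> exists b : nat, forall x, A x -> x <= b%:Z.
Proof.
move=> /finite_seqP[s ->]; exists (\max_(x <- s) `|x|)%N => x /= xs.
apply: le_trans (ler_norm x) _; rewrite -abszE lez_nat.
exact: (@leq_bigmax_seq _ s predT absz).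
Qed.

(** As [S] is not all of [natset], it misses some natural number, and finiteness yields a largest
    one. That one also dominates the negative integers, so [xget] never falls back on its
    default. *)
Lemma frobenius_is_maximum (S : set int) :
  numerical_semigroup S -> S <> natset ->
  is_maximum (~` S) (frobenius S) /\ 0 <= frobenius S.
Proof.
move=> [S_nat _ _ /finite_set_int_bounded[b gap_le]] S_neq.
have gap_ex : exists n : nat, `[< ~ S n%:Z >].
  apply: contrapT => no_gap; apply: S_neq; rewrite eqEsubset; split=> // x x_ge0.
  apply: contrapT => Sx; apply: no_gap; exists `|x|%N; apply/asboolP.
  by rewrite gez0_abs.
have gap_leb n : `[< ~ S n%:Z >] -> (n <= b)%N.
  by move=> /asboolP Sn; rewrite -lez_nat; apply: gap_le; split.
case: (ex_maxnP gap_ex gap_leb) => m /asboolP Sm m_max.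
have m_maximum : is_maximum (~` S) m%:Z.
  split=> // -[n|n] Sn //; rewrite lez_nat.
  by apply: m_max; apply/asboolP.
have frob_max : is_maximum (~` S) (frobenius S) := xgetPex 0 (ex_intro _ _ m_maximum).
by split=> //; apply: le_trans (frob_max.2 _ Sm).
Qed.

Lemma frobenius_odd (S : set int) :
  coe_semigroup S -> S <> natset -> odd `|frobenius S|%N.
Proof.
move=> [S_num S_coe] S_neq.
have [[SF F_ub] F_ge0] := frobenius_is_maximum _ S_num S_neq.
apply: contrapT => F_even; apply: SF.
have SF1 : S (frobenius S + 1).
  by apply: contrapT => /F_ub; lia.
have F1_odd : odd `|(frobenius S + 1)%R|%N by lia.
by apply: (S_coe _ SF1 F1_odd); left; rewrite addrK.
Qed.

Theorem lemma5 (S : set int) (S_coe : coe_semigroup S) (S_neqN : S <> natset) :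
  coe_semigroup (S `|` [set frobenius S - 1; frobenius S]).
Proof.
have F_odd := frobenius_odd _ S_coe S_neqN.
case: S_coe => S_num S_coe.
have [[_ F_ub] F_ge0] := frobenius_is_maximum _ S_num S_neqN.
case: S_num => S_nat S0 SD S_fin.
set F := frobenius S in F_odd F_ub F_ge0 *.
set T := S `|` _.
have T_ge x : F - 1 <= x -> T x.
  move=> x_ge; have [|Sx] := pselect (S x); first by left.
  have := F_ub _ Sx => x_le; right.
  (* Outside [S], [x] lies between [F - 1] and [F], hence is one of the two added points. *)
  have [->|x_neq] := eqVneq x F; [by right | left => /=; lia].
have T_cases x : T x -> S x \/ F - 1 <= x.
  by case=> [|[] /= ->]; [left | right | right; lia].
have T_nat : T `<=` natset.
  by move=> x /T_cases[/S_nat // | ]; rewrite /natset /=; lia.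
split; [split=> // | ].
- by left.
- move=> x y Tx Ty; have := T_nat _ Tx; have := T_nat _ Ty.
  rewrite /natset /= => y_ge0 x_ge0.
  (* Adding a nonnegative summand keeps the sum at or above [F - 1]. *)
  case: (T_cases _ Tx) => [Sx | x_ge]; last by apply: T_ge; lia.
  case: (T_cases _ Ty) => [Sy | y_ge]; last by apply: T_ge; lia.
  by left; apply: SD.
- apply: sub_finite_set S_fin => x [x_nat Tx]; split=> // Sx.
  by apply: Tx; left.
- move=> x Tx x_odd.
  case: (T_cases _ Tx) => [Sx y xy | x_ge y xy].
    by left; apply: S_coe xy.
  (* Since [F - 1] is even, the odd [x] cannot equal it; hence even [x - 1] stays at or above
     [F - 1]. *)
  have : F <= x by lia.
  by move=> Fx; apply: T_ge; case: xy => /= ->; lia.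
Qed.
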